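(* Let $L>0$ be an integer and let $y>1$ be an odd integer. Define the integers $a(L,y,n)$, $n\ge 1$, by \[ \frac{1}{(q,q^{y+2},q^{2y};q^{2y+2})_L} - \frac{1}{(q^2,q^{y},q^{2y+1};q^{2y+2})_L} = \sum_{n=1}^\infty a(L,y,n)\, q^{n}. \] Then $a(L,y,n)\ge 0$ for all $n\ge 1$. Furthermore, $a(L,y,n)=0$ if and only if either $n\in\{2,4,6,\dots,y+1\}\cup\{y\}$ or $(L,y,n)=(1,3,9)$.
   Context: For an integer $L\ge 0$, $(a;q)_L=1$ if $L=0$ and $(a;q)_L=\prod_{j=0}^{L-1}(1-aq^j)$ if $L>0$; and $(a_1,\dots,a_k;q)_L=(a_1;q)_L\cdots(a_k;q)_L$. Equivalently, $a(L,y,n)=P_1(L,y,n)-P_2(L,y,n)$, where $P_1(L,y,n)$ is the number of partitions of $n$ into parts congruent to $1$, $y+2$, or $2y \pmod{2y+2}$ with largest part at most $(2y+2)L-2$, and $P_2(L,y,n)$ is the number of partitions of $n$ into parts congruent to $2$, $y$, or $2y+1 \pmod{2y+2}$ with largest part at most $(2y+2)L-1$. *)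

(* Defs.v *)
From mathcomp Require Import all_boot all_order all_algebra.
Set Implicit Arguments. Unset Strict Implicit. Unset Printing Implicit Defensive.
Import GRing.Theory Num.Theory.

(* geo_coef s n = coefficient of q^n in the formal power series
   prod_{e in s} 1/(1 - q^e)   (all e in s assumed >= 1),
   i.e. the number of tuples (m_e)_{e in s} of nats with sum_e m_e * e = n. *)
Fixpoint geo_coef (s : seq nat) (n : nat) : nat :=
  match s with
  | [::] => (n == 0)%N
  | e :: s' => \sum_(0 <= k < n.+1 | (k * e <= n)%N) geo_coef s' (n - k * e)
  end.

(* The exponent list of (q^a,q^b,q^c;q^m)_L = prod_{j<L} (1-q^{a+mj})(1-q^{b+mj})(1-q^{c+mj}) *)
Definition qpoch_exps (a b c m L : nat) : seq nat :=
  flatten [seq [:: a + m * j; b + m * j; c + m * j] | j <- iota 0 L].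

Definition acoef (L y n : nat) : int :=
  (geo_coef (qpoch_exps 1 (y + 2) (2 * y) (2 * y + 2) L) n)%:Z
  - (geo_coef (qpoch_exps 2 y (2 * y + 1) (2 * y + 2) L) n)%:Z.

(* Main.v *)
(** Put h = y + 1, so that the modulus is 2h, and p_k = 1 + hk, n_k = y + hk =
    p_k + (y - 1). The first product has the exponents p_k (k < 2L) and 2 n_j
    (j < L); the second has n_k (k < 2L) and 2 p_j (j < L). Since
    1/(1 - q^e) = (1 + q^e)/(1 - q^(2e)), the two products become
      prod_(k < 2L) (1 + q^(p_k)) / prod_(L <= k < 2L) (1 - q^(2 p_k))
    and the same expression in the n_k, both times one common factor
    1/prod_(j < L) (1 - q^(2 p_j))(1 - q^(2 n_j)). The common factor contains
    1/(1 - q^2), so it has coefficients that do not decrease when the index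
    grows by 2, and y - 1 is even: replacing any p_k by n_k can only decrease
    coefficients. For strictness it suffices to follow the replacement of three
    factors (1 + q)(1 + q^(y+2))(1 + q^c) over 1/((1 - q^2)(1 - q^(2y))),
    where c = p_2 if L > 1 and, in the absence of p_2, c = 2 p_1 if L = 1. *)

Require Import Defs.
From Stdlib Require Import FunctionalExtensionality.
From mathcomp Require Import all_boot all_order all_algebra.
From mathcomp Require Import zify.
Import GRing.Theory Num.Theory.

(** * Multiplication by q^e, 1 + q^e and 1/(1 - q^e) *)

(** Power series are functions [nat -> nat]; the next three operators multiply
    by q^e, by 1 + q^e and by 1/(1 - q^e). *)
Definition mulXn (e : nat) (f : nat -> nat) (n : nat) : nat :=
  if e <= n then f (n - e) else 0.

Definition mul1Xn (e : nat) (f : nat -> nat) (n : nat) : nat :=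
  f n + mulXn e f n.

Definition divBXn (e : nat) (f : nat -> nat) (n : nat) : nat :=
  \sum_(0 <= k < n.+1 | k * e <= n) f (n - k * e).

Lemma geo_coef_foldr s : geo_coef s = foldr divBXn (geo_coef [::]) s.
Proof. by elim: s => //= e s <-. Qed.

Lemma mulXnD a b f : mulXn a (mulXn b f) = mulXn (a + b) f.
Proof.
apply: functional_extensionality => n; rewrite /mulXn.
case: (leqP a n) => han; last by rewrite ifF //; lia.
have -> : (b <= n - a) = (a + b <= n) by lia.
by case: ifP => // _; congr f; lia.
Qed.

Lemma divBXn_rec e f n : 0 < e -> divBXn e f n = f n + mulXn e (divBXn e f) n.
Proof.
move=> e0; rewrite /divBXn big_mkcond big_nat_recl // mul0n subn0 /=.
congr (_ + _); rewrite /mulXn; case: leqP => hen; last first.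
  by rewrite big1 // => k _; rewrite ifF //; nia.
rewrite -big_mkcond /= [RHS](big_nat_widen _ _ n); last by lia.
apply: eq_big => k; last by move=> _; congr f; lia.
apply/idP/idP => [h|/andP[]]; last by lia.
by apply/andP; split; nia.
Qed.

(** Since [e] is positive, g = f + q^e g determines the coefficients of [g] one after another.
    Identities about 1/(1 - q^e) are proved by checking this equation instead of manipulating
    sums. *)
Lemma divBXn_uniq e f g : 0 < e ->
  (forall n, g n = f n + mulXn e g n) -> g = divBXn e f.
Proof.
move=> e0 hg; apply: functional_extensionality => n.
elim/ltn_ind: n => n IH; rewrite hg divBXn_rec // /mulXn.
by case: leqP => // hen; rewrite IH //; lia.
Qed.

Lemma mulXn_divBXn a e f : 0 < e ->
  mulXn a (divBXn e f) = divBXn e (mulXn a f).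
Proof.
move=> e0; apply: divBXn_uniq => // n.
rewrite mulXnD [e + a]addnC -mulXnD.
rewrite ![mulXn a _ n]/mulXn; case: leqP => // _; exact: divBXn_rec.
Qed.

Lemma divBXnC e1 e2 f : 0 < e1 -> 0 < e2 ->
  divBXn e1 (divBXn e2 f) = divBXn e2 (divBXn e1 f).
Proof.
move=> e10 e20; apply: divBXn_uniq => // n.
rewrite mulXn_divBXn // /divBXn -big_split /=.
apply: eq_bigr => k _; exact: (divBXn_rec e2).
Qed.

Lemma mul1Xn_divBXn a e f : 0 < e ->
  mul1Xn a (divBXn e f) = divBXn e (mul1Xn a f).
Proof.
move=> e0; apply: functional_extensionality => n.
by rewrite /mul1Xn mulXn_divBXn // /divBXn -big_split.
Qed.

(** This is 1/(1 - q^e) = (1 + q^e)/(1 - q^(2e)): unfolding 1/(1 - q^(2e)) once shows that the right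
    side satisfies g = f + q^e g. *)
Lemma divBXn_double e f : 0 < e ->
  divBXn e f = mul1Xn e (divBXn e.*2 f).
Proof.
move=> e0; apply/esym/divBXn_uniq => // n.
rewrite {1}/mul1Xn divBXn_rec ?double_gt0 // -addnn -mulXnD -!addnA.
congr (_ + _); rewrite addnC addnn /mul1Xn {2}/mulXn.
by rewrite {1 3}/mulXn; case: leqP.
Qed.

(** * Products over lists of exponents *)

Definition mul1Xns (s : seq nat) (f : nat -> nat) := foldr mul1Xn f s.
Definition divBXns (s : seq nat) (f : nat -> nat) := foldr divBXn f s.

Lemma divBXns_divBXn e s f : 0 < e -> all (ltn 0) s ->
  divBXns s (divBXn e f) = divBXn e (divBXns s f).
Proof. by move=> e0; elim: s => //= a s IH /andP[a0 /IH ->]; apply: divBXnC. Qed.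

Lemma divBXnsC s t f : all (ltn 0) s -> all (ltn 0) t ->
  divBXns s (divBXns t f) = divBXns t (divBXns s f).
Proof.
move=> hs; elim: t => //= a t IH /andP[a0 /IH <-].
exact: divBXns_divBXn.
Qed.

Lemma mul1Xn_divBXns a s f : all (ltn 0) s ->
  mul1Xn a (divBXns s f) = divBXns s (mul1Xn a f).
Proof. by elim: s => //= e s IH /andP[e0 /IH <-]; rewrite mul1Xn_divBXn. Qed.

Lemma mul1Xns_divBXns s t f : all (ltn 0) t ->
  mul1Xns s (divBXns t f) = divBXns t (mul1Xns s f).
Proof. by move=> ht; elim: s => //= a s ->; apply: mul1Xn_divBXns. Qed.


Lemma geo_coef_cat s t : geo_coef (s ++ t) = divBXns s (geo_coef t).
Proof. by rewrite geo_coef_foldr foldr_cat -geo_coef_foldr. Qed.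

Lemma mul1Xns_cat s t f : mul1Xns (s ++ t) f = mul1Xns s (mul1Xns t f).
Proof. exact: foldr_cat. Qed.

Lemma geo_coef_perm s t : all (ltn 0) s -> perm_eq s t ->
  geo_coef s = geo_coef t.
Proof.
move=> hs hst.
suff [] : all (ltn 0) t /\ geo_coef s = geo_coef t by [].
(* Positivity is part of the invariant because each swap of blocks needs it to commute the
   divisions. *)
pose P u := all (ltn 0) u /\ geo_coef s = geo_coef u.
apply: (@catCA_perm_ind _ P _ s t hst); last by split.
move=> s1 s2 s3; rewrite /P !all_cat => -[/and3P[h1 h2 h3] ->].
by rewrite h1 h2 h3 !geo_coef_cat divBXnsC.
Qed.

Lemma geo_coef_double s t : all (ltn 0) s ->
  geo_coef (s ++ t) = mul1Xns s (geo_coef ([seq e.*2 | e <- s] ++ t)).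
Proof.
rewrite !geo_coef_cat; elim: s => //= e s IH /andP[e0 hs].
rewrite IH // divBXn_double //; congr mul1Xn.
by rewrite -[LHS]/(divBXns [:: e.*2] _) -mul1Xns_divBXns //= double_gt0 e0.
Qed.

(** * Series whose coefficients do not decrease in steps of two *)

(** Equivalently, (1 - q^2) f has nonnegative coefficients. *)
Definition even_nondec (f : nat -> nat) :=
  forall m n, m <= n -> ~~ odd (n - m) -> f m <= f n.

Lemma mulXn_even_nondec a f : even_nondec f -> even_nondec (mulXn a f).
Proof.
move=> hf m n mn hmn; rewrite /mulXn.
case: (leqP a m) => // am; rewrite ifT; last by lia.
by apply: hf; lia.
Qed.

Lemma mul1Xn_even_nondec a f : even_nondec f -> even_nondec (mul1Xn a f).
Proof.
move=> hf m n mn hmn; rewrite /mul1Xn leq_add //; first exact: hf.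
exact: mulXn_even_nondec.
Qed.

Lemma divBXn_even_nondec e f : 0 < e -> even_nondec f ->
  even_nondec (divBXn e f).
Proof.
move=> e0 hf m; elim/ltn_ind: m => m IH n mn hmn.
rewrite !divBXn_rec // leq_add //; first exact: hf.
rewrite /mulXn; case: (leqP e m) => // em; rewrite ifT; last by lia.
by apply: IH; lia.
Qed.

(** The indices [n - b] and [n - a] have the same parity, so g(n - b) <= f(n - b) <= f(n - a). *)
Lemma mulXn_le a b f g n : a <= b -> ~~ odd (b - a) -> even_nondec f ->
  (forall n, g n <= f n) -> mulXn b g n <= mulXn a f n.
Proof.
move=> ab hab hf gf; rewrite /mulXn; case: (leqP b n) => // bn.
rewrite ifT; last by lia.
by apply: leq_trans (gf _) _; apply: hf; lia.
Qed.

Definition even_le (a b : nat) := (a <= b) && ~~ odd (b - a).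

(** The gap is written additively to avoid truncated subtraction. Passing from F - G to (1 + q^a) F
    - (1 + q^b) G adds q^a F - q^b G, which is nonnegative by [mulXn_le]. Bounding the gap from
    below, and not only its sign, is what preserves strictness later. *)
Lemma mul1Xns_gap s t f g : all2 even_le s t -> even_nondec f ->
  (forall n, g n <= f n) ->
  even_nondec (mul1Xns s f) /\
  forall n, mul1Xns t g n + f n <= mul1Xns s f n + g n.
Proof.
elim: s t => [|a s IH] [|b t] //= hst hf gf; first by split=> // n; rewrite addnC.
case/andP: hst => /andP[ab oab] /IH /(_ hf gf) [hm hgap].
split=> [|n]; first exact: mul1Xn_even_nondec.
have := hgap n; rewrite /mul1Xn.
have : mulXn b (mul1Xns t g) n <= mulXn a (mul1Xns s f) n.
  apply: mulXn_le => // k; have := hgap k; have := gf k; lia.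
lia.
Qed.

Lemma divBXn_le a b f g : 0 < a -> even_le a b -> even_nondec f ->
  (forall n, g n <= f n) -> forall n, divBXn b g n <= divBXn a f n.
Proof.
move=> a0 /andP[ab oab] hf gf n; elim/ltn_ind: n => n IH.
have b0 := leq_trans a0 ab.
rewrite !divBXn_rec // leq_add // /mulXn; case: (leqP b n) => // bn.
rewrite ifT; last by lia.
apply: leq_trans (IH _ _) _; first by lia.
by apply: divBXn_even_nondec; rewrite //; lia.
Qed.

(** As for [mul1Xns_gap], with F/(1 - q^a) = F + q^a F/(1 - q^a) supplying the nonnegative
    increment. *)
Lemma divBXns_gap s t f g : all (ltn 0) s -> all2 even_le s t ->
  even_nondec f -> (forall n, g n <= f n) ->
  even_nondec (divBXns s f) /\
  forall n, divBXns t g n + f n <= divBXns s f n + g n.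
Proof.
elim: s t => [|a s IH] [|b t] //=.
  by move=> _ _ hf gf; split=> // n; rewrite addnC.
move=> /andP[a0 hs] /andP[ab hst] hf gf.
have [hm hgap] := IH t hs hst hf gf.
have b0 : 0 < b by case/andP: ab => ab _; apply: leq_trans a0 ab.
split=> [|n]; first exact: divBXn_even_nondec.
have hle k : divBXns t g k <= divBXns s f k by have := hgap k; have := gf k; lia.
have : mulXn b (divBXn b (divBXns t g)) n <= mulXn a (divBXn a (divBXns s f)) n.
  case/andP: (ab) => *; apply: mulXn_le => //; last exact: divBXn_le.
  exact: divBXn_even_nondec.
rewrite ![divBXn _ _ n]divBXn_rec //; have := hgap n; lia.
Qed.

(** The core factors act first on the common series of [u], then the remaining numerators, then the
    denominators [S] and [T]; the last two stages can only enlarge the gap. Hence strictness for the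
    core alone suffices. *)
Lemma geo_coef_gap core rest S core' rest' T u n :
  all (ltn 0) S -> all2 even_le core core' -> all2 even_le rest rest' ->
  all2 even_le S T -> even_nondec (geo_coef u) ->
  mul1Xns (rest' ++ core') (geo_coef (T ++ u)) n + mul1Xns core (geo_coef u) n
    <= mul1Xns (rest ++ core) (geo_coef (S ++ u)) n
       + mul1Xns core' (geo_coef u) n.
Proof.
move=> hS hc hr hST hu.
have hT : all (ltn 0) T.
  elim: S T hS hST => [|a s IH] [|b t] //= /andP[a0 /IH ht] /andP[/andP[ab _] /ht ->].
  by rewrite (leq_trans a0 ab).
have refl k : geo_coef u k <= geo_coef u k by [].
have [hm1 gap1] := mul1Xns_gap _ _ _ _ hc hu refl.
have le1 k : mul1Xns core' (geo_coef u) k <= mul1Xns core (geo_coef u) k.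
  by have := gap1 k; lia.
have [hm2 gap2] := mul1Xns_gap _ _ _ _ hr hm1 le1.
have le2 k : mul1Xns rest' (mul1Xns core' (geo_coef u)) k
    <= mul1Xns rest (mul1Xns core (geo_coef u)) k.
  by have := gap2 k; have := le1 k; lia.
have [_ gap3] := divBXns_gap _ _ _ _ hS hST hm2 le2.
rewrite !geo_coef_cat !mul1Xns_divBXns // !mul1Xns_cat.
have := gap3 n; have := gap2 n; lia.
Qed.

(** * The core comparison over 1/((1 - q^2)(1 - q^(2y))) *)

Local Notation base y := (geo_coef [:: 2 * y; 2]).

(** For even [n], a representation is fixed by the multiplicity of [2 * y], which ranges from 0 to
    the quotient. *)
Lemma baseE y n : 1 < y ->
  base y n = if odd n then 0 else (n %/ (2 * y)).+1.
Proof.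
move=> y_gt1.
have h2 : geo_coef [:: 2] = fun n => nat_of_bool (~~ odd n).
  rewrite geo_coef_foldr /=; apply/esym/divBXn_uniq => // k.
  by rewrite /mulXn; case: k => [|[|k]] //=; rewrite ?subSS ?subn0; lia.
suff -> : base y = fun n => if odd n then 0 else (n %/ (2 * y)).+1 by [].
rewrite geo_coef_foldr /= -[divBXn 2 _]/(foldr divBXn (geo_coef [::]) [:: 2]).
rewrite -geo_coef_foldr h2; apply/esym/divBXn_uniq => [|k]; first by lia.
rewrite /mulXn; case: leqP => hk; last by rewrite divn_small //; case: odd.
have -> : odd (k - 2 * y) = odd k by lia.
case: odd => //=.
rewrite -{1}(subnK hk) divnDr ?dvdnn // divnn.
have -> : 0 < 2 * y by lia.
by rewrite addn1 add1n.
Qed.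

Lemma base_even_nondec y : 1 < y -> even_nondec (base y).
Proof.
move=> y_gt1 m n mn hmn; rewrite !baseE //.
have -> : odd n = odd m by lia.
by case: odd => //; rewrite ltnS leq_div2r.
Qed.

Lemma mulXn_base_le y a b n : 1 < y -> a <= b -> ~~ odd (b - a) ->
  mulXn b (base y) n <= mulXn a (base y) n.
Proof. by move=> y_gt1 ab oab; apply: mulXn_le => //; apply: base_even_nondec. Qed.

(** On even indices [base y] jumps at each multiple of [2 * y]; here v(2y) is a jump lying above n -
    b and at most n - a. *)
Lemma mulXn_base_lt y a b v n : 1 < y -> ~~ odd (n - a) -> ~~ odd (b - a) -> a <= b ->
  a + v * (2 * y) <= n -> n < b + v * (2 * y) ->
  mulXn b (base y) n < mulXn a (base y) n.
Proof.
move=> y_gt1 ona oba ab han hnb; have an := leq_trans (leq_addr _ _) han.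
rewrite /mulXn an !baseE // (negbTE ona).
have hv : v <= (n - a) %/ (2 * y) by rewrite leq_divRL; [rewrite leq_subRL | lia].
case: (leqP b n) => // bn; rewrite ifF; last by lia.
rewrite ltnS (leq_trans _ hv) // ltn_divLR; [rewrite ltn_subLR // | lia].
Qed.

Lemma mul1Xns3 a b c f n : mul1Xns [:: a; b; c] f n =
  f n + mulXn a f n + mulXn b f n + mulXn c f n + mulXn (a + b) f n
  + mulXn (a + c) f n + mulXn (b + c) f n + mulXn (a + b + c) f n.
Proof.
rewrite -!mulXnD /= /mul1Xn /mulXn.
by do ![case: leqP => * //=]; lia.
Qed.

(** Both sides expand into eight shifts of [base y], compared pairwise. No pair goes the wrong way,
    so one strict pair is enough; residues modulo [2 * y] tell which. *)
Lemma core_lt y c c' n : 1 < y -> odd y ->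
  (c, c') = (2 * y + 3, 3 * y + 2) \/ (c, c') = (2 * y + 4, 4 * y + 2) ->
  0 < n -> ~~ ([&& ~~ odd n, 2 <= n & n <= y + 1] || (n == y)) ->
  (c = 2 * y + 4 -> y = 3 -> n <> 9) ->
  mul1Xns [:: y; 2 * y + 1; c'] (base y) n < mul1Xns [:: 1; y + 2; c] (base y) n.
Proof.
move=> y_gt1 y_odd hc n0 hn h9; rewrite !mul1Xns3.
have base_le a b := mulXn_base_le y a b n y_gt1.
have h1 : mulXn y (base y) n <= mulXn 1 (base y) n by apply: base_le; lia.
have h2 : mulXn (2 * y + 1) (base y) n <= mulXn (y + 2) (base y) n by apply: base_le; lia.
have h3 : mulXn c' (base y) n <= mulXn c (base y) n.
  by apply: base_le; case: hc => -[-> ->]; lia.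
have h4 : mulXn (y + (2 * y + 1)) (base y) n <= mulXn (1 + (y + 2)) (base y) n.
  by apply: base_le; lia.
have h5 : mulXn (y + c') (base y) n <= mulXn (1 + c) (base y) n.
  by apply: base_le; case: hc => -[-> ->]; lia.
have h6 : mulXn (2 * y + 1 + c') (base y) n <= mulXn (y + 2 + c) (base y) n.
  by apply: base_le; case: hc => -[-> ->]; lia.
have h7 : mulXn (y + (2 * y + 1) + c') (base y) n <= mulXn (1 + (y + 2) + c) (base y) n.
  by apply: base_le; case: hc => -[-> ->]; lia.
suff : [\/ mulXn y (base y) n < mulXn 1 (base y) n,
  mulXn (2 * y + 1) (base y) n < mulXn (y + 2) (base y) n,
  mulXn (y + (2 * y + 1)) (base y) n < mulXn (1 + (y + 2)) (base y) n
  | mulXn c' (base y) n < mulXn c (base y) n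
    \/ mulXn (y + c') (base y) n < mulXn (1 + c) (base y) n].
  by case=> [||| []]; lia.
have y2 : 0 < 2 * y by lia.
have [hr hq] := (ltn_pmod n y2, divn_eq n (2 * y)).
move: (n %/ (2 * y)) (n %% (2 * y)) hq hr => q r hq hr.
set w := q * (2 * y) in hq.
have ow : ~~ odd w by rewrite /w; lia.
have wS v : q = v.+1 -> w = v * (2 * y) + 2 * y by rewrite /w => ->; lia.
case: (boolP (odd n)) => on.
(* For odd [n], the pair 1, y decides residues below y, and the pair y + 2, 2y + 1 those above y.
   Residue y needs the third factor. *)
- have [ry|ry|ry] := ltngtP r y.
  + by apply: Or41; apply: (mulXn_base_lt _ _ _ q); rewrite -/w; lia.
  + by apply: Or42; apply: (mulXn_base_lt _ _ _ q); rewrite -/w; lia.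
  + apply: Or44; case: hc => -[hc hc'].
    * left; case: q @w hq wS ow => [|q] w hq wS ow; first by lia.
      by have := wS q erefl => hw; apply: (mulXn_base_lt _ _ _ q); lia.
    (* The pair is 2y + 5, 5y + 2. Quotient 0 means n = y; quotient 1 means n = 3y, which is at
       least 2y + 5 unless y = 3, the excluded n = 9. *)
    * right; case: q @w hq wS ow => [|[|q]] w hq wS ow; first by lia.
        have := wS 0 erefl => hw; apply: (mulXn_base_lt _ _ _ 0); lia.
      have := wS q.+1 erefl => hw; apply: (mulXn_base_lt _ _ _ q); lia.
(* For even [n], the pair y + 3, 3y + 1 is strict on windows of length 2y - 2. By parity it misses
   only n = 3y + 1 modulo 2y, where the pair 2y + 4, 4y + 2 is strict for either choice of [c]. *)
- have ny : y + 3 <= n by lia.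
  have hq2 := divn_eq (n - (y + 3)) (2 * y).
  have := ltn_pmod (n - (y + 3)) y2.
  move: ((n - (y + 3)) %/ (2 * y)) ((n - (y + 3)) %% (2 * y)) hq2 => v s hv hs.
  set x := v * (2 * y) in hv.
  have ox : ~~ odd x by rewrite /x; lia.
  case: (ltnP s (2 * y - 2)) => s2.
    by apply: Or43; apply: (mulXn_base_lt _ _ _ v); rewrite -/x; lia.
  apply: Or44; case: hc => -[hc hc']; [right | left];
    by apply: (mulXn_base_lt _ _ _ v); rewrite -/x; lia.
Qed.

(** * Exponents of the two products and reduction to the core *)

#[local] Arguments geo_coef : simpl never.
#[local] Arguments mul1Xns : simpl never.

Definition pexp (y k : nat) := 1 + (y + 1) * k.
Definition nexp (y k : nat) := y + (y + 1) * k.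

(** The three progressions are p_(2j), p_(2j+1) and 2 n_j. *)
Lemma qpoch_exps_perm_P y L :
  perm_eq (qpoch_exps 1 (y + 2) (2 * y) (2 * y + 2) L)
    (map (pexp y) (iota 0 L.*2) ++ map (fun k => (nexp y k).*2) (iota 0 L)).
Proof.
apply/seq.permP => p; rewrite /qpoch_exps; elim: L => // L IH.
rewrite -[L.+1]addn1 doubleD (iotaD 0 L 1) (iotaD 0 L.*2 2) !add0n.
rewrite !map_cat flatten_cat !count_cat IH !count_cat /= /pexp /nexp.
have -> : 1 + (2 * y + 2) * L = 1 + (y + 1) * L.*2 by lia.
have -> : y + 2 + (2 * y + 2) * L = 1 + (y + 1) * L.*2.+1 by lia.
have -> : 2 * y + (2 * y + 2) * L = (y + (y + 1) * L).*2 by lia.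
lia.
Qed.

(** Here the progressions are 2 p_j, n_(2j) and n_(2j+1). *)
Lemma qpoch_exps_perm_N y L :
  perm_eq (qpoch_exps 2 y (2 * y + 1) (2 * y + 2) L)
    (map (nexp y) (iota 0 L.*2) ++ map (fun k => (pexp y k).*2) (iota 0 L)).
Proof.
apply/seq.permP => p; rewrite /qpoch_exps; elim: L => // L IH.
rewrite -[L.+1]addn1 doubleD (iotaD 0 L 1) (iotaD 0 L.*2 2) !add0n.
rewrite !map_cat flatten_cat !count_cat IH !count_cat /= /pexp /nexp.
have -> : 2 + (2 * y + 2) * L = (1 + (y + 1) * L).*2 by lia.
have -> : y + (2 * y + 2) * L = y + (y + 1) * L.*2 by lia.
have -> : 2 * y + 1 + (2 * y + 2) * L = y + (y + 1) * L.*2.+1 by lia.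
lia.
Qed.

Lemma geo_coef_permr s t : perm_eq s t -> all (ltn 0) t ->
  geo_coef s = geo_coef t.
Proof. by rewrite perm_sym => st /geo_coef_perm -/(_ _ st). Qed.

Lemma all2_even_le_map_cat (f g : nat -> nat) s u :
  (forall k, even_le (f k) (g k)) ->
  all2 even_le (map f s ++ u) (map g s ++ u).
Proof.
move=> h; elim: s => [|k s IH] /=; last by rewrite h.
by elim: u => //= k u ->; rewrite /even_le leqnn subnn.
Qed.

Lemma acoef_core_gap L y n : 0 < L -> 1 < y -> odd y ->
  exists c c', [\/ [/\ L = 1, c = 2 * y + 4 & c' = 4 * y + 2]
      | [/\ 1 < L, c = 2 * y + 3 & c' = 3 * y + 2]] /\
  geo_coef (qpoch_exps 2 y (2 * y + 1) (2 * y + 2) L) n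
    + mul1Xns [:: 1; y + 2; c] (base y) n
  <= geo_coef (qpoch_exps 1 (y + 2) (2 * y) (2 * y + 2) L) n
    + mul1Xns [:: y; 2 * y + 1; c'] (base y) n.
Proof.
move=> L0 y1 oy; have hZ := base_even_nondec y y1.
case: L L0 => // -[_|L _].
  (* For L = 1 the denominators 2 p_1 = 2y + 4 and 2 n_1 = 4y + 2 are doubled once more, which
     yields the third numerator factor on each side. *)
  exists (2 * y + 4), (4 * y + 2); split; first by left.
  have e1 : geo_coef (qpoch_exps 1 (y + 2) (2 * y) (2 * y + 2) 1) =
      mul1Xns ([::] ++ [:: 1; y + 2; 2 * y + 4])
        (geo_coef ([:: (2 * y + 4).*2] ++ [:: 2 * y; 2])).
    rewrite /qpoch_exps /= !muln0 !addn0.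
    rewrite -[geo_coef _]/(geo_coef ([:: 1; y + 2] ++ [:: 2 * y])).
    rewrite geo_coef_double /=; last by lia.
    rewrite -[RHS]/(mul1Xns [:: 1; y + 2] (mul1Xns [:: 2 * y + 4]
      (geo_coef ([seq e.*2 | e <- [:: 2 * y + 4]] ++ [:: 2 * y; 2])))).
    rewrite -geo_coef_double /=; last by lia.
    congr (mul1Xns _ _); apply: geo_coef_perm => /=; first by lia.
    have -> : (y + 2).*2 = 2 * y + 4 by lia.
    by rewrite -[1.*2]/2; apply/seq.permP => p /=; lia.
  have e2 : geo_coef (qpoch_exps 2 y (2 * y + 1) (2 * y + 2) 1) =
      mul1Xns ([::] ++ [:: y; 2 * y + 1; 4 * y + 2])
        (geo_coef ([:: (4 * y + 2).*2] ++ [:: 2 * y; 2])).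
    rewrite /qpoch_exps /= !muln0 !addn0.
    have -> : geo_coef [:: 2; y; 2 * y + 1] = geo_coef ([:: y; 2 * y + 1] ++ [:: 2]).
      apply: geo_coef_perm => /=; first by lia.
      by apply/seq.permP => p /=; lia.
    rewrite geo_coef_double /=; last by lia.
    rewrite -[RHS]/(mul1Xns [:: y; 2 * y + 1] (mul1Xns [:: 4 * y + 2]
      (geo_coef ([seq e.*2 | e <- [:: 4 * y + 2]] ++ [:: 2 * y; 2])))).
    rewrite -geo_coef_double /=; last by lia.
    congr (mul1Xns _ _); apply: geo_coef_perm => /=; first by lia.
    have -> : (2 * y + 1).*2 = 4 * y + 2 by lia.
    have -> : y.*2 = 2 * y by lia.
    by apply/seq.permP => p /=; lia.
  by rewrite e1 e2; apply: geo_coef_gap => //=; rewrite /even_le; lia.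
(* These are p_2 and n_2. *)
exists (2 * y + 3), (3 * y + 2); split; first by right.
pose dP k := (pexp y k).*2; pose dN k := (nexp y k).*2.
pose rest := iota 3 L.*2.+1.
(* [K] holds the common denominators of positive index; those of index 0, namely 2 and 2y, form
   [base y]. The doubled exponents from index [L.+2] on differ between the two sides. *)
pose K := map dP (iota 1 L.+1) ++ map dN (iota 1 L.+1).
have posP s : all (ltn 0) (map (pexp y) s).
  by rewrite all_map; apply/allP => k _; rewrite /= /pexp; lia.
have posN s : all (ltn 0) (map (nexp y) s).
  by rewrite all_map; apply/allP => k _; rewrite /= /nexp; lia.
have posdP s : all (ltn 0) (map dP s).
  by rewrite all_map; apply/allP => k _; rewrite /= /dP /pexp; lia.
have posdN s : all (ltn 0) (map dN s).
  by rewrite all_map; apply/allP => k _; rewrite /= /dN /nexp; lia.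
have PE : [:: 1; y + 2; 2 * y + 3] = map (pexp y) [:: 0; 1; 2].
  by rewrite /= /pexp; congr [:: _; _; _]; lia.
have NE : [:: y; 2 * y + 1; 3 * y + 2] = map (nexp y) [:: 0; 1; 2].
  by rewrite /= /nexp; congr [:: _; _; _]; lia.
have ZE : [:: 2 * y; 2] = [:: dN 0; dP 0].
  by rewrite /dN /dP /nexp /pexp; congr [:: _; _]; lia.
have iota2 : iota 0 L.+2.*2 = iota 0 3 ++ rest by [].
have iota2' : iota 0 L.+2.*2 = 0 :: iota 1 L.+1 ++ iota L.+2 L.+2.
  by rewrite -addnn iotaD.
have e1 : geo_coef (qpoch_exps 1 (y + 2) (2 * y) (2 * y + 2) L.+2) =
    mul1Xns (map (pexp y) rest ++ [:: 1; y + 2; 2 * y + 3])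
      (geo_coef ((map dP (iota L.+2 L.+2) ++ K) ++ [:: 2 * y; 2])).
  rewrite (geo_coef_permr _ _ (qpoch_exps_perm_P y L.+2)); last first.
    by rewrite all_cat posP posdN.
  have -> : geo_coef (map (pexp y) (iota 0 L.+2.*2) ++ map dN (iota 0 L.+2)) =
      geo_coef (map (pexp y) (rest ++ iota 0 3) ++ map dN (iota 0 L.+2)).
    apply: geo_coef_perm; first by rewrite all_cat posP posdN.
    by rewrite perm_cat2r perm_map // perm_sym perm_catC.
  rewrite geo_coef_double ?posP // PE -map_cat; congr (mul1Xns _ _).
  apply: geo_coef_perm; first by rewrite -map_comp all_cat posdP posdN.
  apply/seq.permP => p; rewrite ZE -map_comp !count_cat.
  have -> : count p (map (double \o pexp y) (rest ++ iota 0 3)) =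
      count p (map dP (iota 0 L.+2.*2)).
    by apply/seq.permP: p; rewrite perm_map // perm_catC.
  rewrite iota2' /K /= !map_cat !count_cat /=; lia.
have e2 : geo_coef (qpoch_exps 2 y (2 * y + 1) (2 * y + 2) L.+2) =
    mul1Xns (map (nexp y) rest ++ [:: y; 2 * y + 1; 3 * y + 2])
      (geo_coef ((map dN (iota L.+2 L.+2) ++ K) ++ [:: 2 * y; 2])).
  rewrite (geo_coef_permr _ _ (qpoch_exps_perm_N y L.+2)); last first.
    by rewrite all_cat posN posdP.
  have -> : geo_coef (map (nexp y) (iota 0 L.+2.*2) ++ map dP (iota 0 L.+2)) =
      geo_coef (map (nexp y) (rest ++ iota 0 3) ++ map dP (iota 0 L.+2)).
    apply: geo_coef_perm; first by rewrite all_cat posN posdP.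
    by rewrite perm_cat2r perm_map // perm_sym perm_catC.
  rewrite geo_coef_double ?posN // NE -map_cat; congr (mul1Xns _ _).
  apply: geo_coef_perm; first by rewrite -map_comp all_cat posdP posdN.
  apply/seq.permP => p; rewrite ZE -map_comp !count_cat.
  have -> : count p (map (double \o nexp y) (rest ++ iota 0 3)) =
      count p (map dN (iota 0 L.+2.*2)).
    by apply/seq.permP: p; rewrite perm_map // perm_catC.
  rewrite iota2' /K /= !map_cat !count_cat /=; lia.
rewrite e1 e2; apply: geo_coef_gap => //.
- by rewrite !all_cat !posdP posdN.
- by rewrite /= /even_le; lia.
- rewrite -[map _ rest]cats0 -[map (nexp y) rest]cats0.
  by apply: all2_even_le_map_cat => k; rewrite /even_le /pexp /nexp; lia.
- apply: all2_even_le_map_cat => k.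
  by rewrite /even_le /dP /dN /pexp /nexp; lia.
Qed.

(** * Equality at the exceptional indices, and the theorem *)

Lemma geo_coef_gt n s : all (ltn n) s -> geo_coef s n = (n == 0).
Proof.
rewrite geo_coef_foldr; elim: s => //= e s IH /andP[ne /IH h].
rewrite divBXn_rec ?h; last by lia.
by rewrite /mulXn leqNgt ne addn0.
Qed.

Lemma qpoch_exps_succ a b c m L : qpoch_exps a b c m L.+1 =
  [:: a, b, c & qpoch_exps (a + m) (b + m) (c + m) m L].
Proof.
rewrite /qpoch_exps /= !muln0 !addn0 -(addn0 1) iotaDl -map_comp.
congr [:: _, _, _ & flatten _]; apply: eq_map => j /=.
by rewrite !mulnDr !muln1 !addnA.
Qed.

Lemma all_qpoch_exps_gt n a b c m L : n < a -> n < b -> n < c ->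
  all (ltn n) (qpoch_exps a b c m L).
Proof.
move=> na nb nc; apply/allP => e /flatten_mapP[j _].
by rewrite !inE => /or3P[] /eqP ->; rewrite /= ltn_addr.
Qed.

(** Up to y + 1 the first product sees only the exponent 1, so its coefficient is 1. The second sees
    only 2 and y, with y used at most once because 2y > y + 1. *)
Lemma geo_coef_exceptional y L n : 1 < y -> odd y ->
  [&& ~~ odd n, 2 <= n & n <= y + 1] || (n == y) ->
  geo_coef (qpoch_exps 1 (y + 2) (2 * y) (2 * y + 2) L.+1) n =
  geo_coef (qpoch_exps 2 y (2 * y + 1) (2 * y + 2) L.+1) n.
Proof.
move=> y1 oy hn; rewrite !qpoch_exps_succ.
set s := [:: y + 2, _ & _]; set t := (2 * y + 1) :: _.
have hs k : k <= y + 1 -> geo_coef s k = (k == 0).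
  move=> ky; apply: geo_coef_gt; rewrite /= all_qpoch_exps_gt; lia.
have ht k : k <= y + 1 -> geo_coef t k = (k == 0).
  move=> ky; apply: geo_coef_gt; rewrite /= all_qpoch_exps_gt; lia.
have h1 k : k <= y + 1 -> geo_coef (1 :: s) k = 1.
  elim: k => [|k IH] ky; rewrite -[geo_coef _ _]/(divBXn 1 (geo_coef s) _).
    by rewrite divBXn_rec // hs.
  rewrite divBXn_rec // hs // /mulXn subn1 /=; exact: IH (ltnW ky).
have hy k : k <= y + 1 -> geo_coef (y :: t) k = (k == 0) + (k == y).
  move=> ky; rewrite -[geo_coef _ _]/(divBXn y (geo_coef t) _).
  rewrite divBXn_rec ?ht //; last by lia.
  rewrite /mulXn; case: (leqP y k) => yk; last by lia.
  rewrite divBXn_rec ?ht; [|by lia|by lia].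
  by rewrite /mulXn ifF; lia.
have h2 k : k <= y + 1 ->
    geo_coef [:: 2, y & t] k = if odd k then nat_of_bool (y <= k) else 1.
  elim/ltn_ind: k => k IH ky.
  rewrite -[geo_coef _ _]/(divBXn 2 (geo_coef (y :: t)) _) divBXn_rec ?hy //.
  rewrite /mulXn; case: (leqP 2 k) => k2.
    rewrite -[divBXn _ _ _]/(geo_coef [:: 2, y & t] _) IH; [|by lia|by lia].
    have -> : odd (k - 2) = odd k by lia.
    by case: ifP => ok; lia.
  by case: ifP => ok; lia.
rewrite h1 ?h2; [|by lia|by lia].
by case: ifP => on; lia.
Qed.

(** Both counts are 3: parts 1, 5, 6 against parts 2, 3, 7. *)
Lemma geo_coef_1_3_9 :
  geo_coef (qpoch_exps 1 (3 + 2) (2 * 3) (2 * 3 + 2) 1) 9 =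
  geo_coef (qpoch_exps 2 3 (2 * 3 + 1) (2 * 3 + 2) 1) 9.
Proof. by rewrite /qpoch_exps /geo_coef unlock. Qed.

Theorem theorem3 (L y : nat) (hL : (0 < L)%N) (hy : (1 < y)%N) (hodd : odd y) :
  forall n : nat, (1 <= n)%N ->
    (0 <= acoef L y n)%R /\
    (acoef L y n = 0%R <->
       (([&& ~~ odd n, (2 <= n)%N & (n <= y + 1)%N] || (n == y))
        \/ (L = 1%N /\ y = 3%N /\ n = 9%N))).
Proof.
move=> n n0; rewrite /acoef.
set F := geo_coef _ n; set G := geo_coef _ n.
have exc9 : L = 1 /\ y = 3 /\ n = 9 -> F = G.
  by rewrite /F /G => -[-> [-> ->]]; apply: geo_coef_1_3_9.
have exc : [&& ~~ odd n, 2 <= n & n <= y + 1] || (n == y) -> F = G.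
  by rewrite /F /G -(prednK hL); apply: geo_coef_exceptional.
(* Strictness off the exceptional set, with equality on it, gives both the sign and the
   equivalence. *)
have gt : ~ ([&& ~~ odd n, 2 <= n & n <= y + 1] || (n == y)
        \/ (L = 1 /\ y = 3 /\ n = 9)) -> G < F.
  move=> hn; have [c [c' [hc]]] := acoef_core_gap L y n hL hy hodd.
  rewrite -/F -/G => gap.
  suff : mul1Xns [:: y; 2 * y + 1; c'] (base y) n
      < mul1Xns [:: 1; y + 2; c] (base y) n by lia.
  apply: core_lt => //.
  - by case: hc => -[_ -> ->]; [right | left].
  - by apply/negP => h; apply: hn; left.
  - by case: hc => -[hL1 -> _] h y3 n9; [apply: hn; right | lia].
have [hn|hn] : ([&& ~~ odd n, 2 <= n & n <= y + 1] || (n == y)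
        \/ (L = 1 /\ y = 3 /\ n = 9)) \/
    ~ ([&& ~~ odd n, 2 <= n & n <= y + 1] || (n == y)
        \/ (L = 1 /\ y = 3 /\ n = 9)) by lia.
  have -> : F = G by case: hn.
  by rewrite subrr; split.
have := gt hn; split; first by rewrite subr_ge0 lez_nat ltnW.
split=> // /eqP; rewrite subr_eq0 eqz_nat => /eqP; lia.
Qed.
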